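(* The relation algebra $1_7$ is representable over $\mathbb{Z}/n\mathbb{Z}$ for $n=4$, and $\mathrm{CySp}(1_7)=\{4\}$.
   Context: $1_7$ is the finite symmetric integral relation algebra with three atoms $1'$ (identity), $a$, $b$ (all symmetric, i.e. self-converse) whose only mandatory diversity cycle (up to equivalence) among $aaa$, $bbb$, $abb$, $baa$ is $abb$; the others are forbidden. Equivalently its composition is $a;a=1'$, $b;b=1'+a$, $a;b=b;a=b$. For a positive integer $n$, a representation of $1_7$ over the cyclic group $\mathbb{Z}/n\mathbb{Z}$ is a partition of $\mathbb{Z}/n\mathbb{Z}$ into $\mathrm{Id}=\{0\}$ and two nonempty sets $A,B$ with $A=-A$, $B=-B$, such that $A+A=\mathrm{Id}$, $B+B=A\cup\mathrm{Id}$, and $A+B=B$, where $X+Y=\{x+y : x\in X,\ y\in Y\}$ (addition modulo $n$). The algebra is representable over $\mathbb{Z}/n\mathbb{Z}$ if such a partition exists. The cyclic spectrum is $\mathrm{CySp}(1_7)=\{n : n \text{ a positive integer and } 1_7 \text{ is representable over } \mathbb{Z}/n\mathbb{Z}\}$. *)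

(* Defs.v *)
(* MathComp world *)
From mathcomp Require Import all_boot all_algebra.
Set Implicit Arguments.
Unset Strict Implicit.
Unset Printing Implicit Defensive.
Import GRing.Theory.
Local Open Scope ring_scope.

(* The group of integers modulo n, for n > 0, is taken to be 'I_n.-1.+1 with
   addition modulo n.-1.+1 (which is n).  The library's 'Z_n is not used because
   'Z_1 has two elements.  For n = 0 the type below is a junk value, so n > 0
   is required wherever n varies. *)
Definition cyc (n : nat) : finZmodType := 'I_n.-1.+1.

Definition sumset (G : finZmodType) (X Y : {set G}) : {set G} :=
  [set x + y | x in X, y in Y].

Definition oppset (G : finZmodType) (X : {set G}) : {set G} :=
  [set - x | x in X].

(* A and B interpret the two symmetric diversity atoms a and b of 1_7;
   the composition table is a;a = 1', b;b = 1' + a, a;b = b. *)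
Definition is_representation_1_7 (G : finZmodType) (A B : {set G}) : Prop :=
  let Id := [set 0 : G] in
  [/\ [/\ A != set0, B != set0 & Id :|: A :|: B = [set: G]],
      [/\ [disjoint Id & A], [disjoint Id & B] & [disjoint A & B]],
      A = oppset A /\ B = oppset B
    & [/\ sumset A A = Id, sumset B B = A :|: Id & sumset A B = B]].

Definition representable_1_7 (n : nat) : Prop :=
  exists A B : {set cyc n}, is_representation_1_7 A B.

Definition CySp_1_7 (n : nat) : Prop := (0 < n)%N /\ representable_1_7 n.

(* Main.v *)
(* [A + A = {0}] forces [A = {a}] with [2a = 0]. Fixing [b] in [B], the sets [B] and
   [b + B] are equinumerous and [b + B] lies in [B + B = {0, a}], while [B] contains
   [b] and [a + b]; hence [#|B| = 2] and the group has [1 + 1 + 2 = 4] elements. *)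
Require Import Defs.
From mathcomp Require Import all_boot all_algebra.
Import GRing.Theory.

Lemma mem_sumset (G : finZmodType) (X Y : {set G}) x y :
  x \in X -> y \in Y -> (x + y)%R \in sumset X Y.
Proof. by move=> xX yY; apply/imset2P; exists x y. Qed.

(** Translation by a fixed [x] in [X] is injective and sends [Y] into [sumset X Y]. *)
Lemma leq_card_sumset (G : finZmodType) (X Y : {set G}) :
  X != set0 -> #|Y| <= #|sumset X Y|.
Proof.
case/set0Pn=> x xX; rewrite -(card_imset (mem Y) (addrI x)).
by apply/subset_leq_card/subsetP=> _ /imsetP[y yY ->]; apply: mem_sumset.
Qed.

Lemma sumset_set1l (G : finZmodType) (x : G) (Y : {set G}) :
  sumset [set x] Y = [set (x + y)%R | y in Y].
Proof. exact: imset2_set1l. Qed.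

Lemma sumset_set2l (G : finZmodType) (x y : G) (Z : {set G}) :
  sumset [set x; y] Z = [set (x + z)%R | z in Z] :|: [set (y + z)%R | z in Z].
Proof. by rewrite /sumset imset2Ul !imset2_set1l. Qed.

Lemma card_representation_1_7 (G : finZmodType) (A B : {set G}) :
  is_representation_1_7 A B -> #|G| = 4.
Proof.
case=> -[A0 B0 cover] [dIA dIB dAB] _ [AA BB AB].
have cA : #|A| = 1.
  apply/eqP; rewrite eqn_leq card_gt0 A0 andbT.
  by rewrite -(cards1 (0%R : G)) -AA leq_card_sumset.
have cU : #|A :|: [set 0%R]| = 2.
  by move: dIA; rewrite disjoints1 setUC cardsU1 cA => ->.
have cB : #|B| = 2.
  (* Only the first [2], the upper bound, becomes the size of [B + B]; the lower bound is left. *)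
  apply/eqP; rewrite eqn_leq -{1}cU -BB leq_card_sumset //=.
  have [a aA] := set0Pn _ A0; have [b bB] := set0Pn _ B0.
  have a0 : a != 0%R by apply: contraTneq aA => ->; rewrite (disjointFr dIA) ?inE.
  have <- : #|[set (a + b)%R; b]| = 2 by rewrite cards2 -subr_eq0 addrK a0.
  apply/subset_leq_card/subsetP=> x /set2P[] -> //.
  by rewrite -AB mem_sumset.
by move: dIA dIB dAB; rewrite -cardsT -cover -setUA cardsU1 !inE !disjoints1
  -setI_eq0 cardsU cA cB => /negPf-> /negPf-> /eqP->; rewrite cards0.
Qed.

Lemma representable_1_7_4 : representable_1_7 4.
Proof.
pose i k : cyc 4 := inZp k.
(* [2] is the only element of order 2 in Z/4; [B] is the nontrivial coset of the subgroup {0, 2}. *)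
exists [set i 2], [set i 1; i 3]; rewrite /is_representation_1_7 /oppset.
rewrite !sumset_set1l !sumset_set2l !imsetU !imset_set1.
(* Set equalities are checked at each of the four residues; nonemptiness and disjointness remain. *)
split; split; try (by apply/setP=> -[[|[|[|[|k]]]] ltk4] //; rewrite !inE).
- by apply/set0Pn; exists (i 2); rewrite !inE.
- by apply/set0Pn; exists (i 1); rewrite !inE.
- by rewrite disjoints1 !inE.
- by rewrite disjoints1 !inE.
- by rewrite disjoints1 !inE.
Qed.

Theorem theorem3 :
  representable_1_7 4 /\ (forall n : nat, CySp_1_7 n <-> n = 4).
Proof.
split=> [|n]; first exact: representable_1_7_4.
split=> [[n0 [A [B /card_representation_1_7]]]|->]; last first.
  by split; last exact: representable_1_7_4.
(* [cyc n] has [n.-1.+1] elements, which is [n] because [n] is positive. *)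
by rewrite card_ord prednK.
Qed.
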